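(* $\Lambda(\mathbb{SAOL})\cong\mathbf{D}_3\oplus\Lambda(\mathbb{PKA})$, where $\Lambda(\cdot)$ denotes the lattice of subvarieties, $\mathbf{D}_3$ is the three-element chain and $\oplus$ is the ordinal (glued) sum of bounded lattices.
   Context: A BI-lattice is an algebra $(L,\wedge,\vee,\cdot',0,1)$ such that $(L,\wedge,\vee,0,1)$ is a bounded lattice and $\cdot'$ is order-reversing with $a''=a$. A pseudo-Kleene algebra is a BI-lattice with $a\wedge a'\le b\vee b'$ for all $a,b$; $\mathbb{PKA}$ is the variety of pseudo-Kleene algebras. A BZ-lattice is an algebra $(L,\wedge,\vee,\cdot',\cdot^{\sim},0,1)$ such that $(L,\wedge,\vee,\cdot',0,1)$ is a pseudo-Kleene algebra and $\cdot^{\sim}$ is order-reversing with $a\wedge a^{\sim}=0$ and $a\le a^{\sim\sim}=a^{\sim\prime}$ for all $a$; $\mathbb{BZL}$ is the variety of BZ-lattices. A PBZ$^*$-lattice is a BZ-lattice satisfying $(x\wedge x')^{\sim}\approx x^{\sim}\vee x'^{\sim}$ that is paraorthomodular (if $a\le b$ and $a'\wedge b=0$, then $a=b$); PBZ$^*$-lattices form a variety. An antiortholattice is a PBZ$^*$-lattice in which $\{x:x\vee x'=1\}=\{0,1\}$, equivalently a PBZ$^*$-lattice with $0^{\sim}=1$ and $a^{\sim}=0$ for all $a\ne 0$; $\mathbb{AOL}$ is the class of antiortholattices. $V_{\mathbb{BZL}}(\mathbb{C})$ denotes the variety of BZ-lattices generated by $\mathbb{C}$. $\mathbb{SDM}$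 is the variety of PBZ$^*$-lattices satisfying $(x\wedge y)^{\sim}\approx x^{\sim}\vee y^{\sim}$, and $\mathbb{SAOL}=\mathbb{SDM}\cap V_{\mathbb{BZL}}(\mathbb{AOL})$. The ordinal (glued) sum $\mathbf{L}\oplus\mathbf{M}$ of two bounded lattices is obtained by stacking $\mathbf{M}$ on top of $\mathbf{L}$ and identifying the top element of $\mathbf{L}$ with the bottom element of $\mathbf{M}$. *)

(* Defs.v *)
From HB Require Import structures.
From mathcomp Require Import all_boot all_order.
From mathcomp Require Import boolp classical_sets.

Set Implicit Arguments.
Unset Strict Implicit.
Unset Printing Implicit Defensive.

Import Order.TTheory.
Local Open Scope classical_set_scope.

(* An algebra of type (2, 2, 0, 0) extended by a family, indexed by [U], of
   unary operations; no law is assumed.  With constants in the language, all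
   carriers are nonempty. *)
Record alg (U : Type) := Alg {
  car :> Type;
  ameet : car -> car -> car;
  ajoin : car -> car -> car;
  azero : car;
  aone : car;
  aun : U -> car -> car
}.

Arguments azero {U} _.
Arguments aone {U} _.
Arguments aun {U} _ _ _.

Inductive term (U : Type) :=
| Var of nat
| Zero
| One
| Meet of term U & term U
| Join of term U & term U
| Un of U & term U.

Arguments Var {U} _.
Arguments Zero {U}.
Arguments One {U}.

Fixpoint eval (U : Type) (A : alg U) (v : nat -> A) (t : term U) : A :=
  match t with
  | Var n => v n
  | Zero => azero A
  | One => aone A
  | Meet t1 t2 => ameet (eval v t1) (eval v t2)
  | Join t1 t2 => ajoin (eval v t1) (eval v t2)
  | Un u t1 => aun A u (eval v t1)
  end.

Definition equation (U : Type) := (term U * term U)%type.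

Definition sat (U : Type) (A : alg U) (e : equation U) : Prop :=
  forall v : nat -> A, eval v e.1 = eval v e.2.

Definition equational (U : Type) (K : set (alg U)) : Prop :=
  exists E : set (equation U), forall A : alg U, K A <-> (forall e, E e -> sat A e).

Record variety (U : Type) := Variety {
  vclass :> set (alg U);
  vclassP : equational vclass
}.

Lemma variety_eqP (U : Type) (V W : variety U) : V `<=>` W -> V = W.
Proof.
case: V W => [K eK] [K' eK'] /= /seteqP KK'; case: _ / KK' eK' => eK'.
by rewrite (Prop_irrelevance eK eK').
Qed.

Lemma bigcap_equational (U : Type) (F : set (variety U)) :
  equational (\bigcap_(W in F) W).
Proof.
exists [set e | exists2 W, F W & forall A, vclass W A -> sat A e] => A.
split=> [FA e [W FW We] | AE W FW]; first exact/We/FA.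
have [E EW] := vclassP W; apply/EW => e Ee; apply: AE; exists W => // B WB.
by have /EW := WB; apply.
Qed.

Definition variety_inf (U : Type) (F : set (variety U)) : variety U :=
  Variety (bigcap_equational F).

(* The subvariety of [V] generated by a class [C] (contained in [V]). *)
Definition variety_gen (U : Type) (V : variety U) (C : set (alg U)) : variety U :=
  variety_inf [set W : variety U | W `<=` V /\ C `<=` W].

Lemma variety_gen_sub (U : Type) (V : variety U) (C : set (alg U)) :
  C `<=` V -> variety_gen V C `<=` V.
Proof. by move=> CV A; apply; split. Qed.

Lemma sub_variety_gen (U : Type) (V : variety U) (C : set (alg U)) :
  C `<=` variety_gen V C.
Proof. by move=> A CA W [_]; apply. Qed.

Lemma variety_gen_min (U : Type) (V W : variety U) (C : set (alg U)) :
  W `<=` V -> C `<=` W -> variety_gen V C `<=` W.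
Proof. by move=> WV CW A; apply; split. Qed.

(* [subvariety V] is the carrier of the lattice Lambda(V). *)
Record subvariety (U : Type) (V : variety U) := Subvariety {
  subv :> variety U;
  subvP : subv `<=` V
}.

Lemma subv_inj (U : Type) (V : variety U) : injective (@subv U V).
Proof.
move=> [W WV] [W' WV'] /= eW; case: _ / eW WV' => WV'.
by rewrite (Prop_irrelevance WV WV').
Qed.

HB.instance Definition _ (U : Type) (V : variety U) := gen_eqMixin (subvariety V).
HB.instance Definition _ (U : Type) (V : variety U) := gen_choiceMixin (subvariety V).

Fact subvariety_display : Order.disp_t. Proof. exact: Order.Disp tt tt. Qed.

Section SubvarietyLattice.
Context (U : Type) (V : variety U).
Implicit Types W : subvariety V.

Definition subv_le W1 W2 : bool := `[< W1 `<=` W2 >].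

Fact subv_le_refl : reflexive subv_le.
Proof. by move=> W; apply/asboolP. Qed.

Fact subv_le_anti : antisymmetric subv_le.
Proof.
move=> W1 W2 /andP[/asboolP W12 /asboolP W21].
by apply/subv_inj/variety_eqP.
Qed.

Fact subv_le_trans : transitive subv_le.
Proof.
move=> W2 W1 W3 /asboolP W12 /asboolP W23; apply/asboolP.
exact: subset_trans W12 W23.
Qed.

HB.instance Definition _ := Order.Le_isPOrder.Build subvariety_display
  (subvariety V) subv_le_refl subv_le_anti subv_le_trans.

Fact subv_meet_sub W1 W2 :
  variety_inf [set W : variety U | W = W1 \/ W = W2] `<=` V.
Proof. by move=> A W12A; apply: (subvP (s := W1)); apply: W12A; left. Qed.

Definition subv_meet W1 W2 : subvariety V := Subvariety (@subv_meet_sub W1 W2).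

Fact subv_join_sub W1 W2 : variety_gen V (W1 `|` W2) `<=` V.
Proof. by apply: variety_gen_sub => A [/subvP|/subvP]. Qed.

Definition subv_join W1 W2 : subvariety V := Subvariety (@subv_join_sub W1 W2).

Fact subv_lexI W W1 W2 : subv_le W (subv_meet W1 W2) = subv_le W W1 && subv_le W W2.
Proof.
apply/asboolP/andP => [WW12|[/asboolP WW1 /asboolP WW2]].
  by split; apply/asboolP => A /WW12; apply; [left|right].
by move=> A WA W' [->|->]; [exact: WW1|exact: WW2].
Qed.

Fact subv_leUx W1 W2 W : subv_le (subv_join W1 W2) W = subv_le W1 W && subv_le W2 W.
Proof.
apply/asboolP/andP => [W12W|[/asboolP W1W /asboolP W2W]].
  split; apply/asboolP => A WA; apply: W12W; apply: sub_variety_gen;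
  by [left|right].
apply: variety_gen_min; first exact: subvP.
by move=> A []; [exact: W1W|exact: W2W].
Qed.

HB.instance Definition _ := Order.POrder_isMeetSemilattice.Build
  subvariety_display (subvariety V) subv_lexI.
HB.instance Definition _ := Order.POrder_isJoinSemilattice.Build
  subvariety_display (subvariety V) subv_leUx.

Definition subv_bot : subvariety V :=
  Subvariety (variety_gen_sub (@sub0set _ V)).
Definition subv_top : subvariety V := Subvariety (@subset_refl _ V).

Fact subv_le0x W : subv_le subv_bot W.
Proof. by apply/asboolP; apply: variety_gen_min => //; exact: subvP. Qed.

Fact subv_lex1 W : subv_le W subv_top.
Proof. by apply/asboolP; exact: subvP. Qed.

HB.instance Definition _ := Order.hasBottom.Build
  subvariety_display (subvariety V) subv_le0x.
HB.instance Definition _ := Order.hasTop.Build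
  subvariety_display (subvariety V) subv_lex1.

End SubvarietyLattice.

(* MathComp orders 'I_n and bounds 'I_n.+1 without joining the two structures;
   this makes the chain 'I_n.+1 a [tbLatticeType]. *)
HB.saturate ordinal.

Local Open Scope order_scope.

(* [M] on top of [L], the bottom of [M] being identified with the top of [L]:
   the element is kept in the copy of [L] and dropped from the copy of [M]. *)
Record osum d1 (L : tbLatticeType d1) d2 (M : tbLatticeType d2) := OSum {
  oval : L + M;
  ovalP : oval != inr \bot
}.

HB.instance Definition _ d1 (L : tbLatticeType d1) d2 (M : tbLatticeType d2) :=
  [isSub for @oval d1 L d2 M].
HB.instance Definition _ d1 (L : tbLatticeType d1) d2 (M : tbLatticeType d2) :=
  [Choice of osum L M by <:].

Fact osum_display : Order.disp_t. Proof. exact: Order.Disp tt tt. Qed.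

Section OrdinalSum.
Context d1 (L : tbLatticeType d1) d2 (M : tbLatticeType d2).
Implicit Types u v w : osum L M.

Definition osum_le u v : bool :=
  match oval u, oval v with
  | inl a, inl b => a <= b
  | inl _, inr _ => true
  | inr _, inl _ => false
  | inr x, inr y => x <= y
  end.

Fact osum_le_refl : reflexive osum_le.
Proof. by case=> [[a|x] ux]; rewrite /osum_le /=. Qed.

Fact osum_le_anti : antisymmetric osum_le.
Proof.
move=> [[a|x] ux] [[b|y] uy]; rewrite /osum_le //= => /le_anti eq_uv.
  by apply: val_inj; rewrite /= eq_uv.
by apply: val_inj; rewrite /= eq_uv.
Qed.

Fact osum_le_trans : transitive osum_le.
Proof.
by move=> [[b|y] uy] [[a|x] ux] [[c|z] uz]; rewrite /osum_le //=; apply: le_trans.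
Qed.

HB.instance Definition _ := Order.Le_isPOrder.Build osum_display
  (osum L M) osum_le_refl osum_le_anti osum_le_trans.

Definition osum_meet_val (s t : L + M) : L + M :=
  match s, t with
  | inl a, inl b => inl (a `&` b)
  | inl a, inr _ => inl a
  | inr _, inl b => inl b
  | inr x, inr y => if x `&` y == \bot then inl \top else inr (x `&` y)
  end.

Definition osum_join_val (s t : L + M) : L + M :=
  match s, t with
  | inl a, inl b => inl (a `|` b)
  | inl _, inr y => inr y
  | inr x, inl _ => inr x
  | inr x, inr y => inr (x `|` y)
  end.

Fact osum_meetP u v : osum_meet_val (oval u) (oval v) != inr \bot.
Proof.
by case: u v => [[a|x] ux] [[b|y] uy] //=; case: ifPn => // xy; apply: contra xy => /eqP[->].
Qed.

Fact osum_joinP u v : osum_join_val (oval u) (oval v) != inr \bot.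
Proof.
case: u v => [[a|x] ux] [[b|y] uy] //=.
by apply: contra ux => /eqP[/eqP]; rewrite join_eq0 => /andP[/eqP-> _].
Qed.

Definition osum_meet u v : osum L M := OSum (osum_meetP u v).
Definition osum_join u v : osum L M := OSum (osum_joinP u v).

Fact osum_lexI w u v : osum_le w (osum_meet u v) = osum_le w u && osum_le w v.
Proof.
case: w u v => [[c|z] uz] [[a|x] ux] [[b|y] uy]; rewrite /osum_le /= ?andbT ?andbF ?lexI //.
  by case: ifP; rewrite ?lex1.
case: ifP => xy; last by rewrite lexI.
rewrite -lexI (eqP xy) lex0; symmetry; apply/negbTE.
by apply: contra uz => /eqP->.
Qed.

Fact osum_leUx u v w : osum_le (osum_join u v) w = osum_le u w && osum_le v w.
Proof.
by case: u v w => [[a|x] ux] [[b|y] uy] [[c|z] uz]; rewrite /osum_le /= ?andbT ?andbF ?leUx.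
Qed.

HB.instance Definition _ := Order.POrder_isMeetSemilattice.Build
  osum_display (osum L M) osum_lexI.
HB.instance Definition _ := Order.POrder_isJoinSemilattice.Build
  osum_display (osum L M) osum_leUx.

Definition osum_bot : osum L M := @OSum _ L _ M (inl \bot) isT.

(* If [M] is trivial, the top of the sum is that of [L]. *)
Fact osum_topP :
  (if (\top : M) == \bot then inl (\top : L) else inr (\top : M)) != inr \bot.
Proof. by case: ifPn => // M10; apply: contra M10 => /eqP[->]. Qed.

Definition osum_top : osum L M := OSum osum_topP.

Fact osum_le0x u : osum_le osum_bot u.
Proof. by case: u => [[a|x] ux]; rewrite /osum_le /= ?le0x. Qed.

Fact osum_lex1 u : osum_le u osum_top.
Proof.
case: u => [[a|x] ux]; rewrite /osum_le /=; case: ifPn => M10; rewrite ?lex1 //.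
case/negP: ux; apply/eqP; congr inr; apply/eqP.
by rewrite -lex0 -(eqP M10) lex1.
Qed.

HB.instance Definition _ := Order.hasBottom.Build osum_display (osum L M) osum_le0x.
HB.instance Definition _ := Order.hasTop.Build osum_display (osum L M) osum_lex1.

End OrdinalSum.

Definition lattice_isomorphic d1 (L : latticeType d1) d2 (M : latticeType d2) : Prop :=
  exists f : L -> M,
    [/\ bijective f,
        {morph f : x y / x `&` y >-> x `&` y} &
        {morph f : x y / x `|` y >-> x `|` y}].

Local Close Scope order_scope.

Variant bi_op := Compl.
Variant bz_op := Kleene | Brouwer.

Section Classes.
Context (U : Type) (A : alg U).
Local Notation "x ∧ y" := (@ameet U A x y) (at level 40, left associativity).
Local Notation "x ∨ y" := (@ajoin U A x y) (at level 50, left associativity).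
Implicit Types x y z : A.

Definition bounded_lattice : Prop :=
  [/\ associative (@ameet U A) /\ associative (@ajoin U A),
      commutative (@ameet U A) /\ commutative (@ajoin U A),
      (forall x y, x ∧ (x ∨ y) = x) /\ (forall x y, x ∨ (x ∧ y) = x) &
      (forall x, azero A ∧ x = azero A) /\ (forall x, x ∧ aone A = x)].

Definition ale x y : Prop := x ∧ y = x.

Definition order_reversing (f : A -> A) : Prop :=
  forall x y, ale x y -> ale (f y) (f x).

End Classes.

Declare Scope alg_scope.
Delimit Scope alg_scope with alg.
Notation "x ∧ y" := (ameet x y) (at level 40, left associativity) : alg_scope.
Notation "x ∨ y" := (ajoin x y) (at level 50, left associativity) : alg_scope.
Notation "x ≤ y" := (ale x y) (at level 70, no associativity) : alg_scope.
Local Open Scope alg_scope.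

Section BI.
Context (A : alg bi_op).
Local Notation "x ′" := (aun A Compl x) (at level 2, left associativity, format "x ′").
Implicit Types x y : A.

Definition bi_lattice : Prop :=
  [/\ bounded_lattice A, order_reversing (aun A Compl) & forall x, x′′ = x].

Definition pseudo_kleene : Prop :=
  bi_lattice /\ forall x y, x ∧ x′ ≤ y ∨ y′.

End BI.

Definition bi_reduct (A : alg bz_op) : alg bi_op :=
  Alg (@ameet _ A) (@ajoin _ A) (azero A) (aone A) (fun=> aun A Kleene).

Section BZ.
Context (A : alg bz_op).
Local Notation "0" := (azero A).
Local Notation "1" := (aone A).
Local Notation "x ′" := (aun A Kleene x) (at level 2, left associativity, format "x ′").
Local Notation "x ˜" := (aun A Brouwer x) (at level 2, left associativity, format "x ˜").
Implicit Types x y : A.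

Definition bz_lattice : Prop :=
  [/\ pseudo_kleene (bi_reduct A),
      order_reversing (aun A Brouwer),
      forall x, x ∧ x˜ = 0,
      forall x, x ≤ x˜˜ &
      forall x, x˜˜ = x˜′].

Definition paraorthomodular : Prop :=
  forall x y, x ≤ y -> x′ ∧ y = 0 -> x = y.

Definition pbz_star_lattice : Prop :=
  [/\ bz_lattice, (forall x, (x ∧ x′)˜ = x˜ ∨ x′˜) & paraorthomodular].

Definition antiortholattice : Prop :=
  pbz_star_lattice /\ forall x, x ∨ x′ = 1 <-> x = 0 \/ x = 1.

Definition strong_de_morgan : Prop :=
  pbz_star_lattice /\ forall x y, (x ∧ y)˜ = x˜ ∨ y˜.

End BZ.

Lemma equationalI (U : Type) (K1 K2 : set (alg U)) :
  equational K1 -> equational K2 -> equational (K1 `&` K2).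
Proof.
move=> [E1 K1E] [E2 K2E]; exists (E1 `|` E2) => A; split.
  by move=> [/K1E AE1 /K2E AE2] e [/AE1|/AE2].
by move=> AE; split; [apply/K1E|apply/K2E] => e Ee; apply: AE; [left|right].
Qed.

Lemma equational_ext (U : Type) (K1 K2 : set (alg U)) :
  (forall A, K1 A <-> K2 A) -> equational K1 -> equational K2.
Proof. by move=> K12 [E K1E]; exists E => A; rewrite -K12. Qed.

Lemma equational1 (U : Type) (e : equation U) : equational [set A | sat A e].
Proof. by exists [set e] => A; split=> [Ae e' ->|]; last exact. Qed.

Section Environment.
Context (U : Type) (A : alg U).

Definition env3 (x y z : A) (n : nat) : A := nth (azero A) [:: x; y; z] n.

End Environment.

Lemma equational3 (U : Type) (s t : term U) (Q : set (alg U)) :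
  (forall A : alg U, (forall v : nat -> A, eval v s = eval v t) <-> Q A) ->
  equational Q.
Proof. by move=> stQ; apply: equational_ext (equational1 (s, t)). Qed.

Local Notation X0 := (Var 0).
Local Notation X1 := (Var 1).
Local Notation X2 := (Var 2).

Ltac by_equation s t :=
  apply: (@equational3 _ s t) => A;
  let H := fresh "H" in let v := fresh "v" in
  let x := fresh "x" in let y := fresh "y" in let z := fresh "z" in
  split=> [H|H v]; last exact: H;
  first [ by move=> x y z; exact: (H (env3 x y z))
        | by move=> x y; exact: (H (env3 x y x))
        | by move=> x; exact: (H (env3 x x x)) ].

Lemma bounded_lattice_equational (U : Type) : equational (@bounded_lattice U).
Proof.
apply: (@equational_ext U
  ([set A : alg U | associative (@ameet U A)] `&` [set A : alg U | associative (@ajoin U A)] `&`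
   ([set A : alg U | commutative (@ameet U A)] `&` [set A : alg U | commutative (@ajoin U A)]) `&`
   ([set A : alg U | forall x y : A, x ∧ (x ∨ y) = x] `&`
    [set A : alg U | forall x y : A, x ∨ (x ∧ y) = x]) `&`
   ([set A : alg U | forall x : A, azero A ∧ x = azero A] `&`
    [set A : alg U | forall x : A, x ∧ aone A = x]))).
  by move=> A; split=> [[[[? ?] ?] ?]|[? ? ? ?]]; repeat split => //; tauto.
repeat apply: equationalI.
- by_equation (Meet X0 (Meet X1 X2) : term U) (Meet (Meet X0 X1) X2 : term U).
- by_equation (Join X0 (Join X1 X2) : term U) (Join (Join X0 X1) X2 : term U).
- by_equation (Meet X0 X1 : term U) (Meet X1 X0 : term U).
- by_equation (Join X0 X1 : term U) (Join X1 X0 : term U).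
- by_equation (Meet X0 (Join X0 X1) : term U) (X0 : term U).
- by_equation (Join X0 (Meet X0 X1) : term U) (X0 : term U).
- by_equation (Meet Zero X0 : term U) (Zero : term U).
- by_equation (Meet X0 One : term U) (X0 : term U).
Qed.

Section LatticeFacts.
Context (U : Type) (A : alg U) (lA : bounded_lattice A).
Implicit Types x y z : A.

Fact amA : associative (@ameet U A). Proof. by case: lA => -[]. Qed.
Fact ajA : associative (@ajoin U A). Proof. by case: lA => -[]. Qed.
Fact amC : commutative (@ameet U A). Proof. by case: lA => _ -[]. Qed.
Fact ajC : commutative (@ajoin U A). Proof. by case: lA => _ -[]. Qed.
Fact amK x y : x ∧ (x ∨ y) = x. Proof. by case: lA => _ _ []. Qed.
Fact ajK x y : x ∨ (x ∧ y) = x. Proof. by case: lA => _ _ []. Qed.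
Fact am0 x : azero A ∧ x = azero A. Proof. by case: lA => _ _ _ []. Qed.
Fact am1 x : x ∧ aone A = x. Proof. by case: lA => _ _ _ []. Qed.
Fact amm x : x ∧ x = x. Proof. by rewrite -{2}(ajK x x) amK. Qed.
Fact ale_join x y : x ≤ y -> x ∨ y = y.
Proof. by move=> <-; rewrite ajC amC ajK. Qed.
Fact ale_joinl x y : x ≤ x ∨ y. Proof. exact: amK. Qed.
Fact ale_joinr x y : y ≤ x ∨ y. Proof. by rewrite ajC; exact: amK. Qed.
Fact ale_meetl x y : x ∧ y ≤ x. Proof. by rewrite /ale amC amA amm. Qed.
Fact ale_meetr x y : x ∧ y ≤ y. Proof. by rewrite /ale -amA amm. Qed.
Fact ale_trans y x z : x ≤ y -> y ≤ z -> x ≤ z.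
Proof. by move=> xy yz; rewrite /ale -xy -amA yz. Qed.
Fact ale_anti x y : x ≤ y -> y ≤ x -> x = y.
Proof. by move=> xy yx; rewrite -xy amC. Qed.
Fact ale_meet x y z : x ≤ y -> x ≤ z -> x ≤ y ∧ z.
Proof. by move=> xy xz; rewrite /ale amA xy. Qed.
Fact ale_join_lub x y z : x ≤ z -> y ≤ z -> x ∨ y ≤ z.
Proof.
move=> /ale_join xz /ale_join yz.
have <- : (x ∨ y) ∨ z = z by rewrite -ajA yz.
exact: ale_joinl.
Qed.
Fact ale0 x : x ≤ azero A -> x = azero A.
Proof. by rewrite /ale amC am0. Qed.

Fact order_reversingE (f : A -> A) :
  order_reversing f <-> forall x y, f (x ∨ y) ≤ f x.
Proof.
split=> fP x y; first exact/fP/ale_joinl.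
by move=> /ale_join <-; exact: fP.
Qed.

End LatticeFacts.

Lemma equational_rel (U : Type) (K Q Q' : set (alg U)) :
  equational K -> equational Q' -> (forall A, K A -> (Q A <-> Q' A)) ->
  equational (K `&` Q).
Proof.
move=> eK eQ' QQ'; apply: equational_ext (equationalI eK eQ') => A.
by split=> -[KA /(QQ' A KA)].
Qed.

Lemma order_reversing_equational (U : Type) (u : U) :
  equational ([set A : alg U | bounded_lattice A] `&` [set A | order_reversing (aun A u)]).
Proof.
apply: (@equational_rel _ _ _ [set A : alg U | forall x y : A,
  aun A u (x ∨ y) ≤ aun A u x]) => [||A lA]; last exact: order_reversingE.
  exact: bounded_lattice_equational.
by_equation (Meet (Un u (Join X0 X1)) (Un u X0)) (Un u (Join X0 X1)).
Qed.

Lemma pseudo_kleene_equational : equational pseudo_kleene.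
Proof.
apply: (@equational_ext _
  ([set A : alg bi_op | bounded_lattice A] `&` [set A | order_reversing (aun A Compl)] `&`
   [set A : alg bi_op | forall x : A, aun A Compl (aun A Compl x) = x] `&`
   [set A : alg bi_op | forall x y : A, x ∧ aun A Compl x ≤ y ∨ aun A Compl y])).
  by move=> A; split=> [[[[? ?] ?] ?]|[[? ? ?] ?]].
apply: equationalI; first apply: equationalI.
- exact: order_reversing_equational.
- by_equation (Un Compl (Un Compl X0)) (Var 0 : term bi_op).
- by_equation (Meet (Meet X0 (Un Compl X0)) (Join X1 (Un Compl X1))) (Meet X0 (Un Compl X0)).
Qed.

Fixpoint bz_term (t : term bi_op) : term bz_op :=
  match t with
  | Var n => Var n
  | Zero => Zero
  | One => One
  | Meet t1 t2 => Meet (bz_term t1) (bz_term t2)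
  | Join t1 t2 => Join (bz_term t1) (bz_term t2)
  | Un _ t1 => Un Kleene (bz_term t1)
  end.

Fact eval_bi_reduct (A : alg bz_op) (v : nat -> A) (t : term bi_op) :
  eval (A := bi_reduct A) v t = eval v (bz_term t).
Proof. by elim: t => //= [t1 -> t2 ->|t1 -> t2 ->|? t1 ->]. Qed.

Lemma bi_reduct_equational (K : set (alg bi_op)) :
  equational K -> equational [set A | K (bi_reduct A)].
Proof.
move=> [E KE].
exists [set (bz_term e.1, bz_term e.2) | e in E] => A; rewrite /= KE; split.
  by move=> AE _ [e /AE Ae <-] v; rewrite /= -!eval_bi_reduct; exact: Ae.
move=> AE e Ee v; rewrite !eval_bi_reduct.
by apply: (AE (bz_term e.1, bz_term e.2)); exists e.
Qed.

Lemma bz_lattice_equational : equational bz_lattice.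
Proof.
apply: (@equational_ext _
  ([set A | pseudo_kleene (bi_reduct A)] `&`
   ([set A : alg bz_op | bounded_lattice A] `&` [set A | order_reversing (aun A Brouwer)]) `&`
   [set A : alg bz_op | forall x : A, x ∧ aun A Brouwer x = azero A] `&`
   [set A : alg bz_op | forall x : A, x ≤ aun A Brouwer (aun A Brouwer x)] `&`
   [set A : alg bz_op | forall x : A,
     aun A Brouwer (aun A Brouwer x) = aun A Kleene (aun A Brouwer x)])).
  move=> A; split=> [[[[[? [? ?]] ?] ?] ?]|[kA ? ? ? ?]] //.
  by split=> //; split=> //; split=> //; split=> //; split=> //; case: kA => -[].
apply: equationalI; first (apply: equationalI;
  first (apply: equationalI; first apply: equationalI)).
- exact: bi_reduct_equational pseudo_kleene_equational.
- exact: order_reversing_equational.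
- by_equation (Meet X0 (Un Brouwer X0)) (Zero : term bz_op).
- by_equation (Meet X0 (Un Brouwer (Un Brouwer X0))) (Var 0 : term bz_op).
- by_equation (Un Brouwer (Un Brouwer X0)) (Un Kleene (Un Brouwer X0)).
Qed.

(* Given the other axioms of PBZ*-lattices, paraorthomodularity amounts to the
   orthomodular law for the elements of the form [x˜˜]. *)
Section Paraorthomodular.
Context (A : alg bz_op).
Local Notation "0" := (azero A).
Local Notation "1" := (aone A).
Local Notation "x ′" := (aun A Kleene x) (at level 2, left associativity, format "x ′").
Local Notation "x ˜" := (aun A Brouwer x) (at level 2, left associativity, format "x ˜").
Implicit Types x y : A.

Lemma paraorthomodularE : bz_lattice A -> (forall x, (x ∧ x′)˜ = x˜ ∨ x′˜) ->
  paraorthomodular A <->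
  forall x y, (x˜ ∨ (x˜˜ ∧ y˜˜)) ∧ x˜˜ ≤ y˜˜.
Proof.
move=> [[[lA' NR' NK'] _] BR mB BB BN] starP.
have lA : bounded_lattice A := lA'.
have NR x y : x ≤ y -> y′ ≤ x′ by exact: NR'.
have NK x : x′′ = x by exact: NK'.
have amC := amC lA; have amA := amA lA.
have trans := ale_trans lA; have anti := ale_anti lA.
have B3 x : x˜˜˜ = x˜ by apply: (anti); [exact: BR|exact: BB].
have mN x y : (x ∧ y)′ = x′ ∨ y′.
  apply: (anti); last first.
    by apply: ale_join_lub => //; apply: (NR); [exact: ale_meetl|exact: ale_meetr].
  rewrite -[X in _ ≤ X]NK; apply: (NR); apply: ale_meet => //.
    by rewrite -[X in _ ≤ X]NK; apply: (NR); exact: ale_joinl.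
  by rewrite -[X in _ ≤ X]NK; apply: (NR); exact: ale_joinr.
have N0 : 0′ = 1.
  apply: (anti); first by rewrite /ale am1.
  rewrite -[1]NK; apply: (NR); rewrite /ale.
  exact: am0.
have closed_meet x y : (x˜˜ ∧ y˜˜)˜˜ = x˜˜ ∧ y˜˜.
  apply: (anti); last exact: BB.
  apply: ale_meet => //.
    by rewrite -[X in _ ≤ X]B3; apply/BR/BR; exact: ale_meetl.
  by rewrite -[X in _ ≤ X]B3; apply/BR/BR; exact: ale_meetr.
split=> [pA x y|oA].
  set a := x˜˜; set b := y˜˜; set c := a ∧ b.
  have aN : x˜ = a′ by rewrite /a BN NK.
  have cC : c˜˜ = c by exact: closed_meet.
  have cN : c′ = c˜ by rewrite -[in LHS]cC BN NK.
  set d := (x˜ ∨ c) ∧ a.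
  have cd : c ≤ d by apply: ale_meet => //; [exact: ale_joinr|exact: ale_meetl].
  suff -> : d = c by exact: ale_meetr.
  symmetry; apply: pA => //.
  have -> : d = (a ∧ c′)′ ∧ a by rewrite mN NK /d aN.
  set e := a ∧ c′.
  have eC : e˜˜ = e by rewrite /e cN /a -[c˜]B3 closed_meet.
  have eN : e′ = e˜ by rewrite -[in LHS]eC BN NK.
  by rewrite amC -amA -/e eN amC mB.
have orthomod p q : p˜˜ = p -> q˜˜ = q -> p ≤ q -> p′ ∧ q = 0 -> p = q.
  move=> pC qC pq qp0; apply: (anti) => //.
  have := oA q p; rewrite pC qC (amC q p) pq.
  have -> : q˜ ∨ p = 1.
    have -> : q˜ = q′ by rewrite -[in RHS]qC BN NK.
    by rewrite -N0 -qp0 mN NK ajC.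
  by rewrite amC am1.
have B01 : 0˜ = 1.
  have oB0 : 1˜ = 0 by rewrite -[LHS](am1 lA) amC mB.
  by apply: (anti); rewrite -?oB0; [rewrite /ale am1|exact: BB].
have BleN x : x˜ ≤ x′ by rewrite -[x˜]NK; apply: (NR); rewrite -BN; exact: BB.
have sharp x : x ∧ x′ = 0 -> x˜˜ = x.
  move=> xx0.
  have Nx : x′˜ ≤ x by rewrite -[X in _ ≤ X]NK; exact: BleN.
  suff e : x′˜ = x˜˜ by apply: (anti); [rewrite -e|exact: BB].
  apply: (orthomod); rewrite ?B3 //; first exact: trans Nx (BB x).
  by rewrite (BN x) -[LHS]NK mN !NK (ajC lA) -starP xx0 B01 -N0 NK.
move=> x y xy xy0.
have xx0 : x ∧ x′ = 0.
  by apply: ale0 => //; rewrite -xy0 amC; apply: ale_meet => //;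
    [exact: ale_meetl|apply: trans xy; exact: ale_meetr].
have yy0 : y ∧ y′ = 0.
  apply: ale0 => //; rewrite -xy0; apply: ale_meet => //; last exact: ale_meetl.
  by apply: trans (NR _ _ xy); exact: ale_meetr.
by apply: (orthomod) => //; exact: sharp.
Qed.

End Paraorthomodular.

Lemma pbz_star_lattice_equational : equational pbz_star_lattice.
Proof.
apply: (@equational_ext _
  ([set A | bz_lattice A] `&`
   [set A : alg bz_op | forall x : A,
     aun A Brouwer (x ∧ aun A Kleene x) = aun A Brouwer x ∨ aun A Brouwer (aun A Kleene x)] `&`
   [set A | paraorthomodular A])).
  by move=> A; split=> [[[? ?] ?]|[? ? ?]].
apply: (@equational_rel _ _ _ [set A : alg bz_op | forall x y : A,
  let B := aun A Brouwer in
  (B x ∨ (B (B x) ∧ B (B y))) ∧ B (B x) ≤ B (B y)]) => [||A [bA sA]].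
- apply: equationalI; first exact: bz_lattice_equational.
  by_equation (Un Brouwer (Meet X0 (Un Kleene X0)))
    (Join (Un Brouwer X0) (Un Brouwer (Un Kleene X0))).
- pose B t := Un Brouwer t.
  pose l := Meet (Join (B X0) (Meet (B (B X0)) (B (B X1)))) (B (B X0)).
  by_equation (Meet l (B (B X1))) l.
- exact: paraorthomodularE.
Qed.

Lemma strong_de_morgan_equational : equational strong_de_morgan.
Proof.
apply: (@equational_ext _
  ([set A | pbz_star_lattice A] `&`
   [set A : alg bz_op | forall x y : A,
     aun A Brouwer (x ∧ y) = aun A Brouwer x ∨ aun A Brouwer y])) => //.
apply: equationalI; first exact: pbz_star_lattice_equational.
by_equation (Un Brouwer (Meet X0 X1)) (Join (Un Brouwer X0) (Un Brouwer X1)).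
Qed.

Definition PKA : variety bi_op := Variety pseudo_kleene_equational.
Definition BZL : variety bz_op := Variety bz_lattice_equational.
Definition SDM : variety bz_op := Variety strong_de_morgan_equational.
Definition AOL : set (alg bz_op) := antiortholattice.
Definition SAOL : variety bz_op :=
  Variety (equationalI (vclassP SDM) (vclassP (variety_gen BZL AOL))).

(* Main.v *)
Require Import Defs.
From mathcomp Require Import all_boot all_order.
From mathcomp Require Import boolp classical_sets.

(** Write D2 for the two-element algebra and G K for the antiortholattice
    D2 + K + D2 obtained by putting a new bottom below a pseudo-Kleene algebra K
    and a new top above it; D3 is G of the one-element algebra.  The isomorphism
    is read off from the trace of a subvariety W of SAOL: whether W contains D2,
    and for which K it contains G K.  Four facts make this work.

    The trace of W determines W ([saol_separation]).  In an algebra A of SAOL the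
    elements [x˜] are central, because in an antiortholattice they are 0 or 1 and
    the identities expressing centrality pass to the generated variety.  If an
    equation fails in A under some valuation, cut A by a closed element d small
    enough to decide, for each of the finitely many variables, whether its value
    is 0, d, or strictly in the middle of [0, d], but keeping the two sides of the
    equation different.  The middle values lie in an interval K of [0, d] which is
    a pseudo-Kleene algebra, and G K embeds into the quotient [0, d] of A; if there
    is no middle value, D2 is used instead.  Either algebra satisfies the equations
    of A and refutes the given one.

    The set of those K with G K in W is a variety as soon as W contains D3
    ([glue_trace_equational]): evaluating an equation of W in the gluing of the
    term algebra, each variable being sent to the new bottom, the new top or a term,
    turns it into equations between terms, since D3 rules out that the two sides
    fall into different parts.  If W does not contain D3, it
    contains no G K.

    Every subvariety V of PKA arises in this way ([core_variety]).  The constants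
    0 and 1 of K are not constants of G K, but in an equation of V they can be
    replaced by the meet o of all [x ∧ x′], over the variables x and one fresh
    variable, and by [o′]; this does not change its validity in K
    ([core_equationP]), and the factor [o˜˜] makes the result trivially
    true in G K when some variable takes the value 0 or 1.

    Finally the possible traces form the ordinal sum ([osum_leP]): no D2; D2 but no
    D3; D3 and only trivial K; and above that the nontrivial subvarieties of PKA. *)

Set Implicit Arguments.
Unset Strict Implicit.
Unset Printing Implicit Defensive.

Import Order.TTheory.
Local Open Scope classical_set_scope.
Local Open Scope alg_scope.

Local Notation "x ′" := (aun _ Kleene x) (at level 2, left associativity, format "x ′").
Local Notation "x ˜" := (aun _ Brouwer x) (at level 2, left associativity, format "x ˜").

(** * Evaluation of terms *)

(** R is a subalgebra of A * B.  Homomorphisms, and partial isomorphisms between a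
    quotient of A and a subalgebra of B, are all handled as such relations. *)
Record compatible (U : Type) (A B : alg U) (R : A -> B -> Prop) : Prop := Compatible {
  compat0 : R (azero A) (azero B);
  compat1 : R (aone A) (aone B);
  compat_meet : forall x x' y y', R x y -> R x' y' -> R (x ∧ x') (y ∧ y');
  compat_join : forall x x' y y', R x y -> R x' y' -> R (x ∨ x') (y ∨ y');
  compat_un : forall u x y, R x y -> R (aun A u x) (aun B u y)
}.

Lemma eval_compat (U : Type) (A B : alg U) (R : A -> B -> Prop) :
  compatible R -> forall v w, (forall i, R (v i) (w i)) ->
  forall t, R (eval v t) (eval w t).
Proof.
move=> [R0 R1 Rm Rj Ru] v w Rvw.
by elim=> //= [s Rs t Rt|s Rs t Rt|u s Rs]; [exact: Rm|exact: Rj|exact: Ru].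
Qed.

Fixpoint var_bound (U : Type) (t : term U) : nat :=
  match t with
  | Var n => n.+1
  | Zero | One => 0
  | Meet t1 t2 | Join t1 t2 => maxn (var_bound t1) (var_bound t2)
  | Un _ t1 => var_bound t1
  end.

Lemma eq_eval (U : Type) (A : alg U) (v w : nat -> A) (t : term U) :
  (forall i, i < var_bound t -> v i = w i) -> eval v t = eval w t.
Proof.
elim: t => //= [n|s IHs t IHt|s IHs t IHt|u s IHs] vw; first exact: vw.
- by rewrite IHs ?IHt // => i it; apply: vw; rewrite leq_max it ?orbT.
- by rewrite IHs ?IHt // => i it; apply: vw; rewrite leq_max it ?orbT.
- by rewrite IHs.
Qed.

Definition trivial_alg (U : Type) : alg U :=
  @Alg U unit (fun _ _ => tt) (fun _ _ => tt) tt tt (fun _ _ => tt).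

Lemma trivial_in_variety (U : Type) (V : variety U) (A : alg U) :
  (forall x y : A, x = y) -> vclass V A.
Proof. by move=> A1; have [E VE] := vclassP V; apply/VE => e _ v; exact: A1. Qed.

Lemma subv_botE (U : Type) (V : variety U) (A : alg U) :
  vclass (subv_bot V) A <-> forall x y : A, x = y.
Proof.
split=> [botA x y|]; last exact: trivial_in_variety.
pose W : variety U :=
  Variety (equationalI (vclassP V) (equational1 (Var 0 : term U, Var 1))).
have [|_ WA] := botA W; first by split=> // B [].
exact: (WA (fun n => if n is 0 then x else y)).
Qed.

(** * Adding a new bottom and a new top *)

Inductive stack (T : Type) := Bot | Top | Mid of T.
Arguments Bot {T}.
Arguments Top {T}.

Definition stack_map (S T : Type) (f : S -> T) (a : stack S) : stack T :=
  match a with Bot => Bot | Top => Top | Mid x => Mid (f x) end.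

Section Glue.
Context (T : Type) (m j : T -> T -> T) (n : T -> T).

Definition stack_meet (a b : stack T) : stack T :=
  match a, b with
  | Bot, _ | _, Bot => Bot
  | Top, c | c, Top => c
  | Mid x, Mid y => Mid (m x y)
  end.

Definition stack_join (a b : stack T) : stack T :=
  match a, b with
  | Top, _ | _, Top => Top
  | Bot, c | c, Bot => c
  | Mid x, Mid y => Mid (j x y)
  end.

Definition stack_kleene (a : stack T) : stack T :=
  match a with Bot => Top | Top => Bot | Mid x => Mid (n x) end.

Definition stack_brouwer (a : stack T) : stack T :=
  if a is Bot then Top else Bot.

(** Only the operations m, j and n are remembered, not the bounds of the glued
    lattice, so that the empty set can be glued too; this gives D2. *)
Definition glue : alg bz_op :=
  Alg stack_meet stack_join Bot Top
    (fun u => match u with Kleene => stack_kleene | Brouwer => stack_brouwer end).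

(** The laws of pseudo-Kleene algebras without bounds. *)
Record kleene_laws : Prop := KleeneLaws {
  kl_meetA : associative m;
  kl_joinA : associative j;
  kl_meetC : commutative m;
  kl_joinC : commutative j;
  kl_meetK : forall x y, m x (j x y) = x;
  kl_joinK : forall x y, j x (m x y) = x;
  kl_anti : forall x y, m x y = x -> m (n y) (n x) = n y;
  kl_inv : involutive n;
  kl_kleene : forall x y, m (m x (n x)) (j y (n y)) = m x (n x)
}.

Hypothesis T_laws : kleene_laws.

Lemma glue_sdm : strong_de_morgan glue.
Proof.
case: T_laws => mA jA mC jC mK jK nR nK kK.
have mm x : m x x = x by rewrite -{2}(jK x x) mK.
split; last by case=> [||x] [||y].
split; [split|by case|].
- split; last by case=> [||x] [||y] //=; congr Mid; exact: kK.
  split; last by case=> //= x; congr Mid; exact: nK.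
    split; [split| split | split | split].
    + by case=> [||x] [||y] [||z] //=; congr Mid; exact: mA.
    + by case=> [||x] [||y] [||z] //=; congr Mid; exact: jA.
    + by case=> [||x] [||y] //=; congr Mid; exact: mC.
    + by case=> [||x] [||y] //=; congr Mid; exact: jC.
    + by case=> [||x] [||y] //=; congr Mid => //; exact: mK.
    + by case=> [||x] [||y] //=; congr Mid; rewrite ?jK // -{2}(mK x x) jK.
    + by case.
    + by case.
  by case=> [||x] [||y] //= [/nR xy]; congr Mid.
- by case=> [||x] [||y].
- by case.
- by case=> //= x.
- by case.
- by case=> [||x] [||y].
Qed.

Lemma glue_aol : AOL glue.
Proof.
have [P _] := glue_sdm; split=> //.
by case=> [||x]; split=> //=; [left|right|case].
Qed.

Lemma glue_saol : vclass SAOL glue.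
Proof. by split; [exact: glue_sdm|exact/sub_variety_gen/glue_aol]. Qed.

End Glue.

Lemma compat_stack_map (S T : Type) mS jS nS mT jT nT (f : S -> T) :
  {morph f : x y / mS x y >-> mT x y} -> {morph f : x y / jS x y >-> jT x y} ->
  {morph f : x / nS x >-> nT x} ->
  compatible (fun (a : glue mS jS nS) (b : glue mT jT nT) => stack_map f a = b).
Proof.
move=> fm fj fn; split=> //=.
- by move=> [||x] [||x'] y y' <- <- //=; rewrite fm.
- by move=> [||x] [||x'] y y' <- <- //=; rewrite fj.
- by move=> [] [||x] y <- //=; rewrite fn.
Qed.

Definition D2 : alg bz_op :=
  @glue Empty_set (fun x _ => x) (fun x _ => x) id.

Definition bi_glue (K : alg bi_op) : alg bz_op :=
  glue (@ameet _ K) (@ajoin _ K) (aun K Compl).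

Definition D3 : alg bz_op := bi_glue (trivial_alg bi_op).

Lemma D2_saol : vclass SAOL D2.
Proof. by apply: glue_saol; split; case. Qed.

Lemma bi_glue_saol (K : alg bi_op) : vclass PKA K -> vclass SAOL (bi_glue K).
Proof.
move=> [[lK nR nK] kK]; apply: glue_saol; split=> //.
- exact: (amA lK).
- exact: (ajA lK).
- exact: (amC lK).
- exact: (ajC lK).
- exact: (amK lK).
- exact: (ajK lK).
Qed.

(** * The algebras [K] whose gluing lies in a given variety *)

(** Evaluation of a BZ-term in this algebra is its partial evaluation once every
    variable is known to be 0, to be 1 or to lie in the middle part. *)
Definition term_glue : alg bz_op :=
  @glue (term bi_op) (@Meet _) (@Join _) (Un Compl).

(** Gluing is functorial, and [eval u] is a homomorphism from the term algebra. *)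
Lemma bi_glue_eval (K : alg bi_op) (u : nat -> K) (w : nat -> term_glue)
    (t : term bz_op) :
  stack_map (eval u) (eval w t) = eval (A := bi_glue K) (stack_map (eval u) \o w) t.
Proof.
have cR := @compat_stack_map _ _ (@Meet bi_op) (@Join bi_op) (Un Compl)
  (@ameet _ K) (@ajoin _ K) (aun K Compl) (eval u)
  (fun _ _ => erefl) (fun _ _ => erefl) (fun _ => erefl).
exact: (eval_compat cR).
Qed.

Lemma D3_eval (T : Type) m j n (w : nat -> @glue T m j n) (t : term bz_op) :
  stack_map (fun=> tt) (eval w t) = eval (A := D3) (stack_map (fun=> tt) \o w) t.
Proof.
have cR := @compat_stack_map _ _ m j n (@ameet _ (trivial_alg bi_op))
  (@ajoin _ (trivial_alg bi_op)) (aun (trivial_alg bi_op) Compl) (fun=> tt)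
  (fun _ _ => erefl) (fun _ _ => erefl) (fun _ => erefl).
exact: (eval_compat cR).
Qed.

(** Collapsing the middle part of a gluing is a homomorphism onto D3. *)
Lemma bi_glue_D3 (W : variety bz_op) (K : alg bi_op) :
  vclass W (bi_glue K) -> vclass W D3.
Proof.
have [E WE] := vclassP W => /WE KE; apply/WE => e Ee v.
pose w : nat -> bi_glue K := stack_map (fun=> azero K) \o v.
have -> : v = stack_map (fun=> tt) \o w.
  by apply/funext => i; rewrite /w /=; case: (v i) => [||[]].
by rewrite -!D3_eval (KE e Ee w).
Qed.

(** D3 in W says that the two sides of an equation of W always fall into the same
    part of a gluing, so that only equations between middle terms remain. *)
Lemma glue_trace_equational (W : variety bz_op) : vclass W D3 ->
  equational [set K | vclass W (bi_glue K)].
Proof.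
have [E WE] := vclassP W => /WE D3E.
exists [set pq | exists e w, [/\ E e, eval w e.1 = Mid pq.1 :> term_glue &
                              eval w e.2 = Mid pq.2 :> term_glue]] => K.
split=> [/WE KE [p q] [e [w [Ee /= ep eq]]] u | KE].
  have := KE e Ee (stack_map (eval u) \o w).
  by rewrite -!bi_glue_eval ep eq => -[].
apply/WE => e Ee v.
(* [v] factors through the term algebra: middle values become variables *)
pose u i := if v i is Mid y then y else azero K.
pose w i : term_glue := stack_map (fun=> Var i) (v i).
have -> : v = stack_map (eval u) \o w.
  by apply/funext => i; rewrite /w /u /=; case vi: (v i) => [||y] //=; rewrite vi.
rewrite -!bi_glue_eval.
have := D3E e Ee (stack_map (fun=> tt) \o w); rewrite -!D3_eval.
case e1: (eval w e.1) => [||p]; case e2: (eval w e.2) => [||q] //= _; congr Mid.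
by apply: (KE (p, q)); exists e, w.
Qed.

(** * Relativized equations *)

(** The meet of [x ∧ x′] over the variables 0, ..., n.  In a gluing it is the new
    bottom unless all these variables take middle values. *)
Fixpoint core_bottom (n : nat) : term bz_op :=
  let c := Meet (Var n) (Un Kleene (Var n)) in
  if n is n'.+1 then Meet (core_bottom n') c else c.

Fixpoint relativize (o : term bz_op) (t : term bi_op) : term bz_op :=
  match t with
  | Var n => Var n
  | Zero => o
  | One => Un Kleene o
  | Meet t1 t2 => Meet (relativize o t1) (relativize o t2)
  | Join t1 t2 => Join (relativize o t1) (relativize o t2)
  | Un _ t1 => Un Kleene (relativize o t1)
  end.

(** The bound is the index of a variable fresh for e; evaluating that variable to 0
    makes [core_bottom] equal to the 0 of the pseudo-Kleene algebra. *)
Definition core_equation (e : equation bi_op) : equation bz_op :=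
  let o := core_bottom (maxn (var_bound e.1) (var_bound e.2)) in
  let guard := Un Brouwer (Un Brouwer o) in
  (Meet (relativize o e.1) guard, Meet (relativize o e.2) guard).

Section CoreBottom.
Context (T : Type) (m j : T -> T -> T) (n : T -> T) (w : nat -> glue m j n).

Lemma core_bottom_eval N :
  eval w (core_bottom N) = Bot \/
  (exists l, eval w (core_bottom N) = Mid l) /\ forall i, i <= N -> exists y, w i = Mid y.
Proof.
elim: N => [|N [/= ->|[[l /= ->] IH]]]; [| by left |].
  rewrite /=; case w0: (w 0) => [||x] /=; [by left|by left|right].
  by split; [exists (m x (n x))|case=> // _; exists x].
case wN: (w N.+1) => [||x] /=; [by left|by left|right].
split=> [|i]; first by exists (m l (m x (n x))).
by rewrite leq_eqVlt => /predU1P[->|/IH //]; exists x.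
Qed.

End CoreBottom.

Section Relativize.
Context (K : alg bi_op) (kK : pseudo_kleene K).
Local Notation "x ^n" := (aun K Compl x) (at level 2, left associativity, format "x ^n").
Implicit Types x y z l : K.

Let lK : bounded_lattice K. Proof. by case: kK => -[]. Qed.

Fact compl_anti x y : x ≤ y -> y^n ≤ x^n. Proof. by case: kK => -[_ + _] _; apply. Qed.
Fact complK x : x^n^n = x. Proof. by case: kK => -[_ _ +] _; apply. Qed.

Fact compl0 : (azero K)^n = aone K.
Proof.
apply: (ale_anti lK); first exact: am1.
rewrite -[aone K]complK; apply: compl_anti; exact: am0.
Qed.

Fact compl1 : (aone K)^n = azero K.
Proof. by rewrite -compl0 complK. Qed.

(** For [l ≤ l′] the set consisting of 0, 1 and the elements of [[l, l′]] is a
    subalgebra, and [y |-> (y ∨ l) ∧ l′] is a homomorphism from it onto the interval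
    [[l, l′]] with its own bounds.  This is the graph of that homomorphism. *)
Definition clamped l y k : Prop :=
  [/\ l ≤ k, k ≤ l^n & [\/ y = azero K /\ k = l, y = aone K /\ k = l^n | y = k]].

Lemma clamped_inj l y k k' : clamped l y k -> clamped l y k' -> k = k'.
Proof.
suff clampE z : clamped l y z -> z = (y ∨ l) ∧ l^n by move=> /clampE-> /clampE->.
case=> lz zl; have ll : l ≤ l^n := ale_trans lK lz zl.
case=> [[-> ->]|[-> ->]|->].
- by rewrite (ale_join lK (am0 lK l)) ll.
- by rewrite (ajC lK) (ale_join lK (am1 lK l)) (amC lK) (am1 lK).
- by rewrite (ajC lK) (ale_join lK lz) zl.
Qed.

(** For l = 0 the homomorphism is the identity. *)
Lemma clamped0 y k : clamped (azero K) y k -> y = k.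
Proof. by case=> _ _ [[-> ->]|[-> ->]|//]; rewrite ?compl0. Qed.

Lemma clamped_meet l y k y' k' :
  clamped l y k -> clamped l y' k' -> clamped l (y ∧ y') (k ∧ k').
Proof.
move=> [lk kl yk] [lk' kl' yk'].
split; [exact: ale_meet|exact: ale_trans (ale_meetl lK k k') kl|].
case: yk => [[-> kE]|[-> kE]|yk].
- by constructor 1; rewrite (am0 lK) kE lk'.
- rewrite (amC lK) (am1 lK) (amC lK) kE kl'.
  case: yk' => [[-> ->]|[-> ->]|->]; by [constructor 1|constructor 2|constructor 3].
case: yk' => [[-> k'E]|[-> k'E]|yk']; last by constructor 3; rewrite yk yk'.
- by constructor 1; rewrite (amC lK) (am0 lK) (amC lK) k'E lk.
- by constructor 3; rewrite (am1 lK) k'E kl.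
Qed.

Lemma clamped_compl l y k : clamped l y k -> clamped l y^n k^n.
Proof.
move=> [lk kl yk]; split; last 1 first.
  case: yk => [[-> ->]|[-> ->]|->]; rewrite ?compl0 ?compl1 ?complK.
  - by constructor 2.
  - by constructor 1.
  - by constructor 3.
- by rewrite -[l]complK; exact: compl_anti.
- exact: compl_anti.
Qed.

Fact de_morgan x y : x ∨ y = (x^n ∧ y^n)^n.
Proof.
apply: (ale_anti lK).
  apply: (ale_join_lub lK); rewrite -[X in X ≤ _]complK; apply: compl_anti.
    exact: ale_meetl.
  exact: ale_meetr.
rewrite -[X in _ ≤ X]complK; apply/compl_anti/(ale_meet lK); apply: compl_anti.
  exact: ale_joinl.
exact: ale_joinr.
Qed.

Lemma clamped_join l y k y' k' :
  clamped l y k -> clamped l y' k' -> clamped l (y ∨ y') (k ∨ k').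
Proof.
rewrite !de_morgan => yk yk'.
by apply/clamped_compl/clamped_meet; exact: clamped_compl.
Qed.

(** Replacing the constants by l and its complement computes the image of the
    original value under clamping, as clamping is a homomorphism. *)
Lemma relativize_eval (w : nat -> bi_glue K) (u : nat -> K) o l t :
  eval w o = Mid l -> l ≤ l^n ->
  (forall i, i < var_bound t -> w i = Mid (u i) /\ l ≤ u i ∧ (u i)^n) ->
  exists2 k, eval w (relativize o t) = Mid k & clamped l (eval u t) k.
Proof.
move=> wo ll; elim: t => [i|||s IHs t IHt|s IHs t IHt|[] s IHs] wu /=.
- have [wi lu] := wu i (ltnSn i); exists (u i) => //; split; last by constructor 3.
    exact: ale_trans lu (ale_meetl lK _ _).
  by rewrite -[u i]complK; apply: compl_anti; exact: ale_trans lu (ale_meetr lK _ _).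
- by exists l => //; split=> //; [exact: amm|constructor 1].
- by exists l^n; [rewrite wo|split=> //; [exact: amm|constructor 2]].
- have [|ks -> cs] := IHs; first by move=> i it; apply: wu; rewrite leq_max it.
  have [|kt -> ct] := IHt; first by move=> i it; apply: wu; rewrite leq_max it orbT.
  by exists (ks ∧ kt) => //; exact: clamped_meet.
- have [|ks -> cs] := IHs; first by move=> i it; apply: wu; rewrite leq_max it.
  have [|kt -> ct] := IHt; first by move=> i it; apply: wu; rewrite leq_max it orbT.
  by exists (ks ∨ kt) => //; exact: clamped_join.
- have [|ks -> cs] := IHs => //.
  by exists ks^n => //; exact: clamped_compl.
Qed.

Lemma core_bottom_le (w : nat -> bi_glue K) (u : nat -> K) N :
  (forall i, i <= N -> w i = Mid (u i)) ->
  exists2 l, eval w (core_bottom N) = Mid l &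
    forall i, i <= N -> l ≤ u i ∧ (u i)^n.
Proof.
elim: N => [|N IH] wu /=.
  exists (u 0 ∧ (u 0)^n); first by rewrite wu.
  by case=> // _; exact: amm.
have [i iN|l -> lu] := IH; first exact/wu/leqW.
exists (l ∧ (u N.+1 ∧ (u N.+1)^n)); first by rewrite wu.
move=> i; rewrite leq_eqVlt => /predU1P[->|iN]; first exact: ale_meetr.
exact: ale_trans (ale_meetl lK _ _) (lu i iN).
Qed.

(** From right to left the relativized sides are the clamped values of the original
    sides; from left to right the fresh variable is set to 0, where clamping is the
    identity. *)
Lemma core_equationP (e : equation bi_op) :
  sat (bi_glue K) (core_equation e) <-> sat K e.
Proof.
set N := maxn (var_bound e.1) (var_bound e.2).
have core_eval (w : nat -> bi_glue K) u l : eval w (core_bottom N) = Mid l ->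
    (forall i, i <= N -> w i = Mid (u i)) -> (forall i, i <= N -> l ≤ u i ∧ (u i)^n) ->
    forall t, var_bound t <= N ->
    exists2 k, eval w (Meet (relativize (core_bottom N) t)
       (Un Brouwer (Un Brouwer (core_bottom N)))) = Mid k & clamped l (eval u t) k.
  move=> wl wu lu t tN.
  have ll : l ≤ l^n.
    have lu0 := lu 0 isT; apply: (ale_trans lK lu0).
    apply: (ale_trans lK (ale_meetr lK _ _)); apply: compl_anti.
    exact: ale_trans lu0 (ale_meetl lK _ _).
  have [|k /= ->] := relativize_eval (u := u) wl ll (t := t).
    move=> i /leq_trans/(_ tN) iN; have iN' := ltnW iN.
    by split; [exact: wu|exact: lu].
  by rewrite wl; exists k.
have N1 : var_bound e.1 <= N by exact: leq_maxl.
have N2 : var_bound e.2 <= N by exact: leq_maxr.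
split=> [Ge v|Ke w].
  (* N is the fresh variable *)
  pose u i := if i == N then azero K else v i.
  pose w i : bi_glue K := Mid (u i).
  have [//|l wl lu] := @core_bottom_le w u N.
  have l0 : l = azero K.
    apply: (ale0 lK); apply: (ale_trans lK (lu N (leqnn N))).
    by rewrite {1}/u eqxx; exact: ale_meetl.
  have uE t : var_bound t <= N -> eval v t = eval u t.
    move=> tN; apply: eq_eval => i /leq_trans/(_ tN).
    by rewrite /u ltn_neqAle => /andP[/negbTE->].
  rewrite !uE //.
  have [//|//|k1 ek1 c1] := core_eval w u l wl _ lu e.1.
  have [//|//|k2 ek2 c2] := core_eval w u l wl _ lu e.2.
  have := Ge w; rewrite /core_equation -/N ek1 ek2 => -[k12].
  by rewrite l0 in c1 c2; rewrite (clamped0 c1) (clamped0 c2).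
(* if some variable is not in the middle, the guard is the new bottom *)
have [w0|[[l wl] wm]] := core_bottom_eval w N.
  rewrite /core_equation -/N /= w0 /=.
  by case: (eval w _) => [||?]; case: (eval w _) => [||?].
pose u i := if w i is Mid y then y else azero K.
have wu i : i <= N -> w i = Mid (u i) by move=> /wm[y]; rewrite /u => ->.
have [l' wl' lu] := core_bottom_le wu.
have [//|k1 ek1 c1] := core_eval w u l' wl' wu lu e.1.
have [//|k2 ek2 c2] := core_eval w u l' wl' wu lu e.2.
rewrite /core_equation -/N ek1 ek2.
by rewrite (Ke u) in c1; rewrite (clamped_inj c1 c2).
Qed.

End Relativize.

Lemma D2_core_equation (e : equation bi_op) : sat D2 (core_equation e).
Proof.
move=> w; have [w0|[[[]]]] := core_bottom_eval w
  (maxn (var_bound e.1) (var_bound e.2)).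
rewrite /= w0 /=.
by case: (eval w _) => [||?]; case: (eval w _) => [||?].
Qed.

(** * Cutting an algebra of SAOL by a closed element *)

Section BZFacts.
Context (A : alg bz_op) (bA : bz_lattice A).
Local Notation "0" := (azero A).
Local Notation "1" := (aone A).
Implicit Types x y z c d : A.

Fact bz_bounded : bounded_lattice A. Proof. by case: bA => -[[]]. Qed.
Let lA := bz_bounded.
Fact kleene_anti x y : x ≤ y -> y′ ≤ x′. Proof. by case: bA => -[[_ + _] _] _ _ _ _; apply. Qed.
Fact kleeneK x : x′′ = x. Proof. by case: bA => -[[_ _ +] _] _ _ _ _; apply. Qed.
Fact kleene_cond x y : x ∧ x′ ≤ y ∨ y′. Proof. by case: bA => -[_ +] _ _ _ _; apply. Qed.
Fact brouwer_anti x y : x ≤ y -> y˜ ≤ x˜. Proof. by case: bA => _ + _ _ _; apply. Qed.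
Fact meet_brouwer x : x ∧ x˜ = 0. Proof. by case: bA. Qed.
Fact le_brouwer2 x : x ≤ x˜˜. Proof. by case: bA. Qed.
Fact brouwer2E x : x˜˜ = x˜′. Proof. by case: bA. Qed.

Fact brouwer3 x : x˜˜˜ = x˜.
Proof. by apply: (ale_anti lA); [apply/brouwer_anti/le_brouwer2|exact: le_brouwer2]. Qed.

Fact brouwer1 : 1˜ = 0.
Proof. by rewrite -[LHS](am1 lA) (amC lA) meet_brouwer. Qed.

Fact brouwer0 : 0˜ = 1.
Proof.
by apply: (ale_anti lA); [exact: am1|rewrite -[in X in _ ≤ X]brouwer1; exact: le_brouwer2].
Qed.

Fact kleene0 : 0′ = 1. Proof. by rewrite -brouwer1 -brouwer2E brouwer1 brouwer0. Qed.

Fact brouwer_le_kleene x : x˜ ≤ x′.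
Proof. by rewrite -[x˜]kleeneK -brouwer2E; apply/kleene_anti/le_brouwer2. Qed.

Fact brouwer_join x y : (x ∨ y)˜ = x˜ ∧ y˜.
Proof.
apply: (ale_anti lA).
  by apply: (ale_meet lA); apply: brouwer_anti; [exact: ale_joinl|exact: ale_joinr].
apply: (ale_trans lA (le_brouwer2 _)); apply: brouwer_anti.
apply: (ale_join_lub lA); apply: (ale_trans lA (le_brouwer2 _)); apply: brouwer_anti.
  exact: ale_meetl.
exact: ale_meetr.
Qed.

End BZFacts.

(** [x˜] is sharp: [(x˜ ∧ x˜˜)˜ = 0˜ = 1]. *)
Lemma aol_brouwer_cases (A : alg bz_op) : AOL A ->
  forall x : A, x˜ = azero A \/ x˜ = aone A.
Proof.
move=> [[bA starA _] sharpA] x; apply/sharpA.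
rewrite -(brouwer2E bA x) (ajC (bz_bounded bA)).
have := starA x˜; rewrite -(brouwer2E bA x) (meet_brouwer bA) (brouwer0 bA).
by rewrite (brouwer3 bA).
Qed.

Lemma saol_sat (e : equation bz_op) : (forall B, AOL B -> sat B e) ->
  forall A, vclass SAOL A -> sat A e.
Proof.
move=> AOLe A [_ VA].
pose W : variety bz_op := Variety (equationalI bz_lattice_equational (equational1 e)).
have [|//] := VA W; split=> [B []//|B aolB]; split; last exact: AOLe.
by case: aolB => -[].
Qed.

Section Cut.
Context (A : alg bz_op) (sA : vclass SAOL A).
Local Notation "0" := (azero A).
Local Notation "1" := (aone A).
Implicit Types x y z c d : A.

Let bA : bz_lattice A. Proof. by case: sA => -[[]]. Qed.
Let lA : bounded_lattice A := bz_bounded bA.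

Definition closed d := d˜˜ = d.

Fact closed_brouwer x : closed x˜. Proof. exact: brouwer3. Qed.

Fact closed1 : closed 1. Proof. by rewrite /closed (brouwer1 bA) (brouwer0 bA). Qed.

Fact closed_meet c d : closed c -> closed d -> closed (c ∧ d).
Proof. by move=> <- <-; rewrite -(brouwer_join bA); exact: closed_brouwer. Qed.

Fact closed_kleene d : closed d -> d′ = d˜.
Proof. by move=> {1}<-; rewrite (brouwer2E bA) (kleeneK bA). Qed.

(** Case analysis on a closed element [z˜˜] proves an identity: the class AOL
    generates enough of the variety, and there [z˜˜] is 0 or 1. *)
Lemma saol_case (s t : term bz_op) :
  (forall (B : alg bz_op) (v : nat -> B), AOL B ->
     (v 2)˜˜ = azero B \/ (v 2)˜˜ = aone B -> eval v s = eval v t) ->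
  sat A (s, t).
Proof.
move=> st; apply: saol_sat => // B aB v; apply: st => //.
exact: aol_brouwer_cases.
Qed.

Local Notation X := (Var 0).
Local Notation Y := (Var 1).
Local Notation D := (Un Brouwer (Un Brouwer (Var 2))).

Lemma cut_join d x y : closed d -> (x ∨ y) ∧ d = (x ∧ d) ∨ (y ∧ d).
Proof.
move=> cd.
suff /(_ (env3 x y d)) : sat A (Meet (Join X Y) D, Join (Meet X D) (Meet Y D)).
  by rewrite /= /env3 /= cd.
apply: saol_case => B v aB /= v2.
have lB : bounded_lattice B by apply: bz_bounded; case: aB => -[].
case: v2 => ->; rewrite ?(am1 lB) // !(amC lB _ (azero B)) !(am0 lB).
by rewrite (ale_join lB (am0 lB _)).
Qed.

Lemma cut_split d x : closed d -> x = (x ∧ d) ∨ (x ∧ d˜).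
Proof.
move=> cd.
suff /(_ (env3 x x d)) : sat A (X, Join (Meet X D) (Meet X (Un Brouwer D))).
  by rewrite /= /env3 /= cd.
apply: saol_case => B v aB /= v2.
have bB : bz_lattice B by case: aB => -[].
have lB : bounded_lattice B by exact: bz_bounded.
case: v2 => ->; rewrite ?(brouwer0 bB) ?(brouwer1 bB) (am1 lB) (amC lB _ (azero B)) (am0 lB).
  by rewrite (ale_join lB (am0 lB _)).
by rewrite (ajC lB) (ale_join lB (am0 lB _)).
Qed.

Lemma cut_un u d x : closed d -> aun A u x ∧ d = aun A u (x ∧ d) ∧ d.
Proof.
move=> cd.
suff /(_ (env3 x x d)) : sat A (Meet (Un u X) D, Meet (Un u (Meet X D)) D).
  by rewrite /= /env3 /= cd.
apply: saol_case => B v aB /= v2.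
have lB : bounded_lattice B by apply: bz_bounded; case: aB => -[].
by case: v2 => ->; rewrite ?(am1 lB) // !(amC lB _ (azero B)) !(am0 lB).
Qed.

Lemma cut_meet d x y : (x ∧ y) ∧ d = (x ∧ d) ∧ (y ∧ d).
Proof. by rewrite !(amA lA) -(amA lA x d y) (amC lA d y) !(amA lA) -!(amA lA) (amm lA). Qed.

(** A closed element c splits [0, d] into two factors, and two elements that agree
    on both factors agree. *)
Lemma cut_neq c d x y : closed c -> x ∧ d <> y ∧ d ->
  x ∧ (d ∧ c) <> y ∧ (d ∧ c) \/ x ∧ (d ∧ c˜) <> y ∧ (d ∧ c˜).
Proof.
move=> cc xyd; apply/not_andP => -[E1 E2]; apply: xyd.
by rewrite (cut_split (x ∧ d) cc) (cut_split (y ∧ d) cc) -!(amA lA) E1 E2.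
Qed.

(** In the factor [0, d] the value y is neither 0 nor d in any further nontrivial
    factor: for d = 1 in an antiortholattice, this says that y is neither 0 nor 1. *)
Definition middle d y : Prop := [/\ y ≤ d, d ≤ y˜˜ & d ≤ y′˜˜].

Definition decided d x : Prop := [\/ x ∧ d = 0, x ∧ d = d | middle d (x ∧ d)].

Lemma decided_of d x : closed d ->
  [\/ d ≤ x˜, d ≤ x′˜ | d ≤ x˜˜ /\ d ≤ x′˜˜] -> decided d x.
Proof.
move=> cd; case=> [dx|dx|[dx dx']].
- by constructor 1; rewrite -dx (amC lA d) (amA lA) (meet_brouwer bA) (am0 lA).
- constructor 2; rewrite (amC lA); apply: (ale_trans lA dx).
  by rewrite -[X in _ ≤ X](kleeneK bA); exact: brouwer_le_kleene.
- constructor 3; split; first exact: ale_meetr.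
    have -> : (x ∧ d)˜˜ = x˜˜ ∧ d.
      have [[_ dm] _] := sA.
      by rewrite dm (brouwer_join bA) cd.
    by apply: (ale_meet lA); [|exact: amm].
  apply: (ale_trans lA dx'); apply/(brouwer_anti bA)/(brouwer_anti bA)/(kleene_anti bA).
  exact: ale_meetl.
Qed.

(** For each variable x the closed elements [x˜], [x′˜] and [x˜˜ ∧ x′˜˜] partition
    the unit, so below one of them the two given elements remain different; the
    variables are treated one after the other. *)
Lemma decide_vars (v : nat -> A) x y N : x <> y ->
  exists d, [/\ closed d, x ∧ d <> y ∧ d &
    forall i, i < N -> [\/ d ≤ (v i)˜, d ≤ (v i)′˜ | d ≤ (v i)˜˜ /\ d ≤ (v i)′˜˜]].
Proof.
move=> xy; elim: N => [|N [d [cd xyd IH]]].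
  by exists 1; split=> //; [exact: closed1|rewrite !(am1 lA)].
have step d' : closed d' -> x ∧ d' <> y ∧ d' -> d' ≤ d ->
    [\/ d' ≤ (v N)˜, d' ≤ (v N)′˜ | d' ≤ (v N)˜˜ /\ d' ≤ (v N)′˜˜] ->
    exists d, [/\ closed d, x ∧ d <> y ∧ d & forall i, i < N.+1 ->
      [\/ d ≤ (v i)˜, d ≤ (v i)′˜ | d ≤ (v i)˜˜ /\ d ≤ (v i)′˜˜]].
  move=> cd' xyd' dd' kN; exists d'; split=> // i.
  rewrite ltnS leq_eqVlt => /predU1P[-> //|/IH [di|di|[di di']]].
  - by constructor 1; exact: (ale_trans lA dd').
  - by constructor 2; exact: (ale_trans lA dd').
  - by constructor 3; split; exact: (ale_trans lA dd').
have clo := closed_brouwer.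
have [xy1|xy1] := cut_neq (clo (v N)) xyd.
  apply: (step _ _ xy1); first exact: closed_meet.
    exact: ale_meetl.
  by constructor 1; exact: ale_meetr.
have [xy2|xy2] := cut_neq (clo (v N)′) xy1.
  apply: (step _ _ xy2); first by do 2?apply: closed_meet.
    by apply: (ale_trans lA (ale_meetl lA _ _)); exact: ale_meetl.
  by constructor 2; exact: ale_meetr.
apply: (step _ _ xy2); first by do 2?apply: closed_meet.
  by apply: (ale_trans lA (ale_meetl lA _ _)); exact: ale_meetl.
constructor 3; split; last exact: ale_meetr.
by apply: (ale_trans lA (ale_meetl lA _ _)); exact: ale_meetr.
Qed.

Section Middle.
Context (d : A) (cd : closed d) (d_neq0 : d <> 0).

Fact meet_closed_brouwer : d ∧ d˜ = 0. Proof. exact: meet_brouwer. Qed.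

Lemma middle_meet x y : middle d x -> middle d y -> middle d (x ∧ y).
Proof.
move=> [xd dx dx'] [yd dy dy']; split.
- exact: (ale_trans lA (ale_meetl lA x y)).
- have [[_ dm] _] := sA.
  by rewrite dm (brouwer_join bA); exact: ale_meet.
- apply: (ale_trans lA dx'); apply/(brouwer_anti bA)/(brouwer_anti bA)/(kleene_anti bA).
  exact: ale_meetl.
Qed.

Lemma cut_kleeneK x : x ≤ d -> (x′ ∧ d)′ ∧ d = x.
Proof. by move=> xd; rewrite -(cut_un Kleene) // (kleeneK bA). Qed.

Lemma middle_kleene x : middle d x -> middle d (x′ ∧ d).
Proof.
move=> [xd dx dx']; split; first exact: ale_meetr.
  have [[_ dm] _] := sA.
  by rewrite dm (brouwer_join bA) cd; apply: (ale_meet lA) => //; exact: amm.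
apply: (ale_trans lA dx); apply/(brouwer_anti bA)/(brouwer_anti bA).
by rewrite -[X in X ≤ _](kleeneK bA); apply/(kleene_anti bA); exact: ale_meetl.
Qed.

Lemma middle_neq0 x : middle d x -> x <> 0.
Proof.
move=> [_ dx _] x0; apply: d_neq0; apply: (ale0 lA).
by apply: (ale_trans lA dx); rewrite x0 (brouwer0 bA) (brouwer1 bA); exact: am0.
Qed.

Lemma middle_neqd x : middle d x -> x <> d.
Proof.
move=> /middle_kleene/middle_neq0 + xd; apply.
by rewrite xd closed_kleene // (amC lA) meet_closed_brouwer.
Qed.

Context (T : Type) (m j : T -> T -> T) (n : T -> T) (i : T -> A).
Hypothesis i_inj : injective i.
Hypothesis i_middle : forall t, middle d (i t).
Hypothesis i_meet : {morph i : s t / m s t >-> s ∧ t}.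
Hypothesis i_join : {morph i : s t / j s t >-> s ∨ t}.
Hypothesis i_compl : forall t, i (n t) = (i t)′ ∧ d.

(** The embedding of the gluing of a set of middle elements into [0, d]. *)
Definition unstack (a : stack T) : A :=
  match a with Bot => 0 | Top => d | Mid t => i t end.

Lemma unstack_le a : unstack a ∧ d = unstack a.
Proof. by case: a => [||t] /=; [exact: am0|exact: amm|case: (i_middle t)]. Qed.

Lemma unstack_inj : injective unstack.
Proof.
case=> [||s] [||t] //= st.
- by case: (d_neq0 (esym st)).
- by case: (middle_neq0 (i_middle t)).
- by case: (middle_neqd (i_middle t)).
- by case: (middle_neq0 (i_middle s)).
- by case: (middle_neqd (i_middle s)).
- by rewrite (i_inj st).
Qed.

(** Cutting by d is a homomorphism onto [0, d], and [unstack] is a homomorphism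
    into it. *)
Lemma unstack_compat :
  compatible (fun (x : A) (a : glue m j n) => x ∧ d = unstack a).
Proof.
have j0 z : z ∨ 0 = z by rewrite (ajC lA) (ale_join lA (am0 lA z)).
have jd a : d ∨ unstack a = d.
  by rewrite (ajC lA); apply: (ale_join lA); exact: unstack_le.
split=> /=.
- exact: am0.
- by rewrite (amC lA) (am1 lA).
- move=> x x' a b xa xb; rewrite cut_meet xa xb.
  case: a b {xa xb} => [||s] [||t] /=; rewrite ?(am0 lA) ?(amm lA) ?i_meet //.
  + by rewrite (amC lA) (am0 lA).
  + by have := unstack_le (Mid t); rewrite (amC lA).
  + by rewrite (amC lA) (am0 lA).
  + exact: (unstack_le (Mid s)).
- move=> x x' a b xa xb; rewrite cut_join // xa xb.
  case: a b {xa xb} => [||s] [||t] /=; rewrite ?j0 ?(amm lA) ?i_join //.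
  + by rewrite (ajC lA) j0.
  + by rewrite (ajC lA) j0.
  + exact: (jd Top).
  + exact: (jd (Mid t)).
  + by rewrite (ajC lA); exact: (jd (Mid s)).
- move=> u x a xa; rewrite cut_un // xa.
  case: u; case: a {xa} => [||t] /=.
  + by rewrite (kleene0 bA) (amC lA) (am1 lA).
  + by rewrite closed_kleene // (amC lA) meet_closed_brouwer.
  + by rewrite i_compl.
  + by rewrite (brouwer0 bA) (amC lA) (am1 lA).
  + by rewrite (amC lA) meet_closed_brouwer.
  + have [_ dt _] := i_middle t; rewrite -dt (amC lA d) (amA lA).
    by rewrite (meet_brouwer bA) (am0 lA).
Qed.

Lemma cut_sat e : sat A e -> sat (glue m j n) e.
Proof.
move=> Ae w; apply: unstack_inj.
have ev := @eval_compat _ _ _ _ unstack_compat (unstack \o w) w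
  (fun k => unstack_le (w k)).
by rewrite -!ev Ae.
Qed.

Lemma cut_unsat e (v : nat -> A) (w : nat -> stack T) :
  (forall k, v k ∧ d = unstack (w k)) ->
  eval v e.1 ∧ d <> eval v e.2 ∧ d -> ~ sat (glue m j n) e.
Proof.
move=> vw ne Ge; apply: ne.
by rewrite !(eval_compat unstack_compat (w := w) vw) Ge.
Qed.

End Middle.
End Cut.

(** * Separating an equation by a gluing *)

Section Interval.
Context (A : alg bz_op) (sA : vclass SAOL A) (d l : A).
Hypotheses (cd : closed d) (ml : middle d l) (ll : l ≤ l′ ∧ d).
Local Notation u := (l′ ∧ d).

Let bA : bz_lattice A. Proof. by case: sA => -[[]]. Qed.
Let lA : bounded_lattice A := bz_bounded bA.

Definition in_interval (y : A) : Prop := l ≤ y /\ y ≤ u.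

Fact interval_meet x y : in_interval x -> in_interval y -> in_interval (x ∧ y).
Proof.
move=> [lx xu] [ly _]; split; first exact: ale_meet.
exact: (ale_trans lA (ale_meetl lA _ _)).
Qed.

Fact interval_join x y : in_interval x -> in_interval y -> in_interval (x ∨ y).
Proof.
move=> [lx xu] [_ yu]; split; last exact: ale_join_lub.
exact: (ale_trans lA lx (ale_joinl lA _ _)).
Qed.

Fact interval_top_kleene : u′ ∧ d = l.
Proof. by apply: cut_kleeneK => //; case: ml. Qed.

Fact cut_kleene_anti (x y : A) : x ≤ y -> y′ ∧ d ≤ x′ ∧ d.
Proof.
move=> xy; apply: (ale_meet lA); last exact: ale_meetr.
by apply: (ale_trans lA (ale_meetl lA _ _)); exact: kleene_anti.
Qed.

Fact interval_kleene x : in_interval x -> in_interval (x′ ∧ d).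
Proof.
move=> [lx xu]; split; last exact: cut_kleene_anti.
by rewrite -{1}interval_top_kleene; exact: cut_kleene_anti.
Qed.

Fact interval_bottom : in_interval l. Proof. by split=> //; exact: amm. Qed.
Fact interval_top : in_interval u. Proof. by split=> //; exact: amm. Qed.

(** The interval [[l, l′ ∧ d]] of middle elements, with the complement inherited
    from the factor [0, d]. *)
Definition interval : alg bi_op :=
  @Alg bi_op {x : A | in_interval x}
    (fun x y => exist _ _ (interval_meet (svalP x) (svalP y)))
    (fun x y => exist _ _ (interval_join (svalP x) (svalP y)))
    (exist _ _ interval_bottom) (exist _ _ interval_top)
    (fun _ x => exist _ _ (interval_kleene (svalP x))).

Lemma interval_inj (x y : interval) : sval x = sval y -> x = y.
Proof.
case: x y => [x px] [y py] /= xy; case: _ / xy py => py.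
by congr exist; exact: Prop_irrelevance.
Qed.

Lemma interval_middle (x : interval) : middle d (sval x).
Proof.
case: x => x [lx xu] /=; have [ud _ du] := middle_kleene sA cd ml.
have [_ dl _] := ml; split; first exact: (ale_trans lA xu ud).
- by apply: (ale_trans lA dl); apply/(brouwer_anti bA)/(brouwer_anti bA).
- by apply: (ale_trans lA du); apply/(brouwer_anti bA)/(brouwer_anti bA)/(kleene_anti bA).
Qed.

Lemma interval_pka : vclass PKA interval.
Proof.
split; first split.
- split; split.
  + by move=> x y z; apply: interval_inj; exact: amA.
  + by move=> x y z; apply: interval_inj; exact: ajA.
  + by move=> x y; apply: interval_inj; exact: amC.
  + by move=> x y; apply: interval_inj; exact: ajC.
  + by move=> x y; apply: interval_inj; exact: amK.
  + by move=> x y; apply: interval_inj; exact: ajK.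
  + by move=> x; apply: interval_inj; case: (svalP x).
  + by move=> x; apply: interval_inj; case: (svalP x).
- by move=> x y /(congr1 sval) xy; apply: interval_inj; exact: cut_kleene_anti.
- move=> x; apply: interval_inj; apply: cut_kleeneK => //.
  by case: (interval_middle x).
- move=> x y; apply: interval_inj => /=.
  have [xd _ _] := interval_middle x; have [yd _ _] := interval_middle y.
  rewrite -[X in _ ∧ (X ∨ _)]yd -cut_join //.
  apply: (ale_meet lA).
    rewrite (amA lA); apply: (ale_trans lA (ale_meetl lA _ _)).
    exact: kleene_cond.
  rewrite (amA lA); exact: ale_meetr.
Qed.

End Interval.

(** The bound l is the meet of the middle values and of their complements in
    [0, d]; middle elements are closed under both operations. *)
Lemma middle_lower_bound (A : alg bz_op) (sA : vclass SAOL A) (d : A) (v : nat -> A) N :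
  closed d ->
  (forall i, i < N -> ~ middle d (v i ∧ d)) \/
  exists l, [/\ middle d l, l ≤ l′ ∧ d & forall i, i < N -> middle d (v i ∧ d) ->
    in_interval d l (v i ∧ d)].
Proof.
move=> cd; have bA : bz_lattice A by case: sA => -[[]].
have lA := bz_bounded bA.
(* what is below [y] and its complement is also below its own complement *)
have down l y : middle d y -> l ≤ y -> l ≤ y′ ∧ d -> l ≤ l′ ∧ d /\ in_interval d l y.
  move=> my ly ly'; split.
    by apply: (ale_trans lA ly'); exact: cut_kleene_anti.
  split=> //; case: (my) => yd _ _; rewrite -{1}(cut_kleeneK sA cd yd).
  exact: cut_kleene_anti.
elim: N => [|N IH]; first by left.
have [my|nmy] := pselect (middle d (v N ∧ d)); last first.
  case: IH => [nm|[l [ml ll lv]]]; [left|right; exists l; split=> //] => i;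
    by rewrite ltnS leq_eqVlt => /predU1P[->|]; auto.
right; set y := v N ∧ d in my; set b := y ∧ (y′ ∧ d).
have mb : middle d b by apply: middle_meet => //; exact: middle_kleene.
case: IH => [nm|[l [ml ll lv]]].
  have [bb iy] := down b y my (ale_meetl lA _ _) (ale_meetr lA _ _).
  exists b; split=> // i; rewrite ltnS leq_eqVlt => /predU1P[-> //|iN mi].
  by case: (nm i iN).
have [bb iy] : l ∧ b ≤ (l ∧ b)′ ∧ d /\ in_interval d (l ∧ b) y.
  apply: down => //; apply: (ale_trans lA (ale_meetr lA _ _)).
    exact: ale_meetl.
  exact: ale_meetr.
exists (l ∧ b); split=> //; first exact: middle_meet.
move=> i; rewrite ltnS leq_eqVlt => /predU1P[-> //|iN mi].
have [li iu] := lv i iN mi; split; first exact: (ale_trans lA (ale_meetl lA _ _)).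
by apply: (ale_trans lA iu); apply: cut_kleene_anti => //; exact: ale_meetl.
Qed.

Lemma sat_D2 (A : alg bz_op) (e : equation bz_op) :
  vclass SAOL A -> azero A <> aone A -> sat A e -> sat D2 e.
Proof.
move=> sA A01; apply: (@cut_sat A sA (aone A) (closed1 sA) (nesym A01)
  _ _ _ _ (fun t : Empty_set => match t with end)); by case.
Qed.

(** The algebra obtained in either case is a subalgebra of a factor [0, d] of A;
    equations of A hold in D2 by [sat_D2] when A is nontrivial. *)
Lemma saol_separation (A : alg bz_op) (e : equation bz_op) :
  vclass SAOL A -> ~ sat A e ->
  (azero A <> aone A /\ ~ sat D2 e) \/
  exists K, [/\ vclass PKA K, forall e', sat A e' -> sat (bi_glue K) e' &
                ~ sat (bi_glue K) e].
Proof.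
move=> sA /existsNP[v0 ne0].
have bA : bz_lattice A by case: sA => -[[]].
have lA := bz_bounded bA.
set N := maxn (var_bound e.1) (var_bound e.2).
(* variables that do not occur are sent to 0, which every cut decides *)
pose v i := if i < N then v0 i else azero A.
have vE t : var_bound t <= N -> eval v0 t = eval v t.
  by move=> tN; apply: eq_eval => i /leq_trans/(_ tN); rewrite /v => ->.
have {}ne0 : eval v e.1 <> eval v e.2.
  by rewrite -!vE //; [exact: leq_maxr|exact: leq_maxl].
have [d [cd ned dv]] := decide_vars sA v N ne0.
have {}dv i : decided d (v i).
  have [iN|Ni] := ltnP i N; first exact/decided_of/dv.
  by rewrite /v ltnNge Ni; constructor 1; exact: am0.
have d_neq0 : d <> azero A.
  by move=> d0; apply: ned; rewrite d0 !(amC lA _ (azero A)) !(am0 lA).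
have [nm|[l [ml ll lv]]] := middle_lower_bound sA v N cd.
  left; split.
    by move=> A01; apply: d_neq0; rewrite -(am1 lA d) -A01 (amC lA) (am0 lA).
  have /choice[w vw] k : exists a : stack Empty_set,
      v k ∧ d = unstack d (fun t : Empty_set => match t with end) a.
    case: (dv k) => [vk|vk|mk]; [by exists Bot|by exists Top|].
    have [kN|Nk] := ltnP k N; first by case: (nm k kN).
    by exists Bot; rewrite /v ltnNge Nk /=; exact: am0.
  by apply: (cut_unsat sA cd _ _ _ _ vw ned); case.
right; exists (interval sA cd ml ll).
have imid := @interval_middle A sA d l cd ml ll.
split.
- exact: interval_pka.
- by move=> e' Ae'; apply: (cut_sat (i := sval) sA cd d_neq0) => //; exact: interval_inj.
have /choice[w vw] k : exists a : stack (interval sA cd ml ll), v k ∧ d = unstack d sval a.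
  case: (dv k) => [vk|vk|mk]; [by exists Bot|by exists Top|].
  have [kN|Nk] := ltnP k N; first by exists (Mid (exist _ _ (lv k kN mk))).
  by exists Bot; rewrite /v ltnNge Nk /=; exact: am0.
by apply: (cut_unsat (i := sval) sA cd _ _ _ _ vw ned).
Qed.

(** * The isomorphism *)

Lemma lattice_isomorphic_mono d1 (L : latticeType d1) d2 (M : latticeType d2)
    (f : L -> M) :
  {mono f : x y / (x <= y)%O} -> (forall y, exists x, f x = y) ->
  lattice_isomorphic L M.
Proof.
move=> fmono /choice[g gK]; exists f; split.
- exists g => // x; apply: (inc_inj fmono); exact: gK.
- move=> x y; apply: le_anti.
  rewrite lexI !fmono leIl leIr /=.
  by rewrite -(gK (Order.meet _ _)) fmono lexI -!fmono gK
    leIl leIr.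
- move=> x y; apply: le_anti; apply/andP; split.
    by rewrite -(gK (Order.join (f x) _)) fmono leUx -!fmono gK
      leUl leUr.
  by rewrite leUx !fmono leUl leUr.
Qed.

Local Notation sum_lattice := (osum 'I_3 (subvariety PKA)).

Definition has_D2 (Y : sum_lattice) : bool :=
  if oval Y is inl i then 0 < i else true.

(** The algebras K with G K in the variety to be associated with Y.  The top of the
    chain stands for the bottom of the upper summand, the class of trivial algebras. *)
Definition cores (Y : sum_lattice) : set (alg bi_op) :=
  match oval Y with
  | inl i => [set K | i = 2 :> nat /\ vclass (subv_bot PKA) K]
  | inr V => vclass V
  end.

Definition traces (W : subvariety SAOL) (Y : sum_lattice) : Prop :=
  (vclass W D2 <-> has_D2 Y) /\
  forall K, vclass PKA K -> (vclass W (bi_glue K) <-> cores Y K).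

Lemma cores_pka Y K : cores Y K -> vclass PKA K.
Proof.
rewrite /cores; case: (oval Y) => [i [_ K0]|V]; last exact: subvP.
exact: (subvP K0).
Qed.

Lemma osum_leP (Y1 Y2 : sum_lattice) :
  (Y1 <= Y2)%O <-> (has_D2 Y1 -> has_D2 Y2) /\ cores Y1 `<=` cores Y2.
Proof.
have bot1 : vclass (subv_bot PKA) (trivial_alg bi_op) by apply/subv_botE => -[] [].
rewrite -[(Y1 <= Y2)%O]/(osum_le Y1 Y2) /osum_le /has_D2 /cores.
case: Y1 Y2 => [[i|V1] /= p1] [[j|V2] /= p2].
- rewrite -[(i <= j)%O]/(i <= j); split=> [ij|[ij02 ij2]].
    split=> [i0|K [i2 K0]]; first exact: leq_trans ij.
    by split=> //; apply/eqP; rewrite eqn_leq (ltn_ord j : j <= 2); move: ij; rewrite i2.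
  case: i j {p1 p2} ij02 ij2 => [[|[|[|//]]] /= pi] [j /= pj] ij02 ij2 //.
    exact: ij02.
  by have [->] := ij2 (trivial_alg bi_op) (conj erefl bot1).
- split=> // _; split=> // K [_ K0].
  have [botK _] := subv_botE PKA K.
  exact/trivial_in_variety/botK.
- split=> // -[_ V1j]; case/negP: p1; apply/eqP; congr inr.
  apply: le_anti; rewrite le0x andbT.
  by apply/asboolP => K /V1j[].
- split=> [/asboolP V12|[_ V12]]; first by split.
  exact/asboolP.
Qed.

Lemma sat_variety (W : variety bz_op) (A B : alg bz_op) :
  (forall e, sat A e -> sat B e) -> vclass W A -> vclass W B.
Proof.
by have [E WE] := vclassP W => AB /WE AE; apply/WE => e Ee; exact/AB/AE.
Qed.

(** By separation, an equation of W2 refuted in W1 is refuted by D2 or by some G K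
    in W1, and the traces put that algebra into W2. *)
Lemma traces_le (W1 W2 : subvariety SAOL) Y1 Y2 : traces W1 Y1 -> traces W2 Y2 ->
  (W1 <= W2)%O = (Y1 <= Y2)%O.
Proof.
move=> [t1 s1] [t2 s2]; apply/idP/idP.
  move=> /asboolP W12; apply/osum_leP; split.
    by move=> /t1 /W12 /t2.
  move=> K KY; have kK := cores_pka KY.
  by apply/(s2 K kK)/W12/(s1 K kK).
move=> /osum_leP[Y12 KY12]; apply/asboolP => A W1A.
have [E2 WE2] := vclassP W2; apply/WE2 => e Ee.
apply: contrapT => nAe.
have [[A01 n2]|[K [kK WK nK]]] := saol_separation (subvP W1A) nAe.
  apply: n2; suff /WE2 : vclass W2 D2 by apply.
  apply/t2/Y12/t1; apply: sat_variety (W1A) => e'.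
  by apply: sat_D2 A01; exact: subvP W1A.
apply: nK; suff /WE2 : vclass W2 (bi_glue K) by apply.
by apply/(s2 K kK)/KY12/(s1 K kK); exact: sat_variety W1A.
Qed.

Lemma bi_glue_D2 (W : subvariety SAOL) K : vclass W (bi_glue K) -> vclass W D2.
Proof.
by move=> WK; apply: sat_variety (WK) => e; apply: sat_D2 => //; exact: subvP WK.
Qed.

Lemma traces_exists (W : subvariety SAOL) : exists Y, traces W Y.
Proof.
have [W2|nW2] := pselect (vclass W D2); last first.
  exists (@OSum _ 'I_3 _ (subvariety PKA) (inl ord0) isT); split=> // K _.
  by split=> [/bi_glue_D2//|[]].
have [W3|nW3] := pselect (vclass W D3); last first.
  exists (@OSum _ 'I_3 _ (subvariety PKA) (inl (Ordinal (isT : 1 < 3))) isT).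
  by split=> // K _; split=> [/bi_glue_D3//|[]].
pose V := @Subvariety _ PKA
  (Variety (equationalI (vclassP PKA) (glue_trace_equational W3)))
  (fun K VK => proj1 VK).
have [V0|V0] := eqVneq V (subv_bot PKA).
  exists (@OSum _ 'I_3 _ (subvariety PKA) (inl ord_max) isT); split=> // K kK.
  have KV : vclass V K <-> vclass (subv_bot PKA) K by rewrite V0.
  by split=> [WK|[_ /KV[]]] //; split=> //; apply/KV.
have VP : (inr V : 'I_3 + subvariety PKA) != inr Order.bottom.
  by apply: contra V0 => /eqP/(congr1 (fun s => if s is inr x then x else V))/= ->.
by exists (OSum VP); split=> // K kK; split=> [WK|[]].
Qed.

(** The relativized equations of V define it. *)
Lemma core_variety (V : subvariety PKA) : exists W : subvariety SAOL,
  vclass W D2 /\ forall K, vclass PKA K -> (vclass W (bi_glue K) <-> vclass V K).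
Proof.
have [E VE] := vclassP V.
have eqW : equational [set A | forall e, E e -> sat A (core_equation e)].
  exists [set core_equation e | e in E] => A; split=> [AE _ [e Ee <-]|AE e Ee].
    exact: AE.
  by apply: AE; exists e.
exists (@Subvariety _ SAOL (Variety (equationalI (vclassP SAOL) eqW))
  (fun K VK => proj1 VK)).
split=> [|K kK].
  by split; [exact: D2_saol|move=> e _; exact: D2_core_equation].
split=> [[_ KE]|/VE KE].
  by apply/VE => e Ee; apply/(core_equationP kK)/KE.
by split; [exact: bi_glue_saol|move=> e Ee; apply/(core_equationP kK)/KE].
Qed.

Lemma traces_onto Y : exists W, traces W Y.
Proof.
have small e : exists W : subvariety SAOL, forall A, vclass W A <-> vclass SAOL A /\ sat A e.
  by exists (@Subvariety _ SAOL (Variety (equationalI (vclassP SAOL) (equational1 e)))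
    (fun K VK => proj1 VK)).
case: Y => [[[[|[|[|//]]] pi]|V] p].
- have [W WE] := small (Zero, One); exists W; split.
    by split=> // /WE[_ /(_ (fun=> Bot))].
  by move=> K _; split=> [/WE[_ /(_ (fun=> Bot))]|[]].
- have [W WE] := small (Join (Var 0) (Un Kleene (Var 0)), One); exists W; split.
    split=> // _; apply/WE; split; first exact: D2_saol.
    by move=> v /=; case: (v 0) => [||[]].
  by move=> K _; split=> [/WE[_ /(_ (fun=> Mid (azero K)))]|[]].
- have [W [W2 WK]] := core_variety (subv_bot PKA); exists W; split=> // K kK.
  by split=> [/(WK K kK)|[_ /(WK K kK)]].
- by have [W [W2 WK]] := core_variety V; exists W; split.
Qed.

Theorem corollary4p28 :
  lattice_isomorphic (subvariety SAOL) (osum 'I_3 (subvariety PKA)).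
Proof.
have /choice[f fP] := traces_exists.
apply: (@lattice_isomorphic_mono _ _ _ _ f) => [W1 W2|Y].
  by rewrite (traces_le (fP W1) (fP W2)).
have [W WY] := traces_onto Y; exists W.
apply: le_anti.
by rewrite -(traces_le (fP W) WY) -(traces_le WY (fP W)) lexx.
Qed.
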